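(* Let $n \geq 1$ and let $b_1, \ldots, b_n$ be complex numbers. Consider the following system of equations in the complex variables $z_1, \ldots, z_n$: $$z_1^j + z_2^j + \cdots + z_n^j = b_j, \qquad 1 \leq j \leq n.$$ Then this system has a solution $(z_1, \ldots, z_n) \in \mathbb{C}^n$, and it is unique up to permutation of the coordinates. Moreover, the solution satisfies $|z_i| \leq C_n M$ for all $1 \leq i \leq n$, where $$C_n = \frac{1}{\sin \frac{\pi}{2n}}, \qquad M = \max_{1 \leq j \leq n} |b_j|^{1/j}.$$ *)

(* Defs.v *)
From mathcomp Require Import all_boot all_order all_algebra.
From mathcomp Require Import perm complex.
From mathcomp Require Import all_classical all_reals all_analysis.

Set Implicit Arguments.
Unset Strict Implicit.
Unset Printing Implicit Defensive.

Import Order.TTheory GRing.Theory Num.Theory.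

Local Open Scope ring_scope.
Local Open Scope complex_scope.

(* R-valued complex modulus; the norm `|x| on R[i] takes its values in R[i]. *)
Definition cmod (R : realType) (x : R[i]) : R := ComplexField.Normc.normc x.

(* 'I_n is {0, ..., n-1}: the index j stands for j + 1, so b j is b_{j+1}. *)
Definition power_sum_solution (R : realType) (n : nat) (b z : 'I_n -> R[i]) :
    Prop :=
  forall j : 'I_n, \sum_(i < n) z i ^+ j.+1 = b j.

(* The terms are nonnegative, so starting the maximum at 0 does not change it
   when 0 < n.  Note that 0 `^ r = 0 for r != 0. *)
Definition max_root (R : realType) (n : nat) (b : 'I_n -> R[i]) : R :=
  \big[Num.max/0]_(j < n) (cmod (b j) `^ (j.+1%:R^-1)).

Definition root_bound_const (R : realType) (n : nat) : R :=
  (sin (pi / (2 * n%:R)))^-1.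

(* Main.v *)
(** Newton's identities turn the power sums [b] into the coefficients of the
    monic polynomial with roots [z i] and back, so existence is the fundamental
    theorem of algebra and uniqueness is unique factorization.  They also give
    [|a k| <= M ^+ k] for the coefficients [a k] of ['X^(n - k)], and Cauchy's
    bound then yields [|z i| <= 2 M].  Since [sin (pi / 6) = 1 / 2], this is
    enough when [3 <= n]; for [n = 2] one uses
    [(z1 - z2)^2 = 2 b2 - b1^2] and [|2 z1|^2 <= 2 |z1 + z2|^2 + 2 |z1 - z2|^2],
    and [n = 1] is immediate. *)

Require Import Defs.
From mathcomp Require Import all_boot all_order all_algebra.
From mathcomp Require Import perm complex.
From mathcomp Require Import all_classical all_reals all_analysis.
From mathcomp Require Import ring lra zify.

Set Implicit Arguments.
Unset Strict Implicit.
Unset Printing Implicit Defensive.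

Import Order.TTheory GRing.Theory Num.Theory.

Local Open Scope ring_scope.
Local Open Scope complex_scope.

(** * Newton's identities for a product of linear factors *)

(* [p k] plays the role of the power sum of exponent [k.+1], and [a k] that of
   the coefficient of ['X^(n - k)], i.e. [(-1) ^+ k] times the k-th elementary
   symmetric function. *)
Definition newton_rel (R : pzRingType) (n : nat) (a p : nat -> R) : Prop :=
  a 0%N = 1 /\ forall k, (k < n)%N ->
    k.+1%:R * a k.+1 = - \sum_(i < k.+1) a i * p (k - i)%N.

Lemma deriv_prod_XsubC (R : comNzRingType) (n : nat) (z : 'I_n -> R) :
  (\prod_i ('X - (z i)%:P))^`() = \sum_i \prod_(j | j != i) ('X - (z j)%:P).
Proof.
elim: n z => [|n IHn] z; first by rewrite !big_ord0 -polyC1 derivC.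
rewrite big_ord_recl derivM derivXsubC mul1r IHn [RHS]big_ord_recl.
congr (_ + _).
  rewrite [RHS]big_mkcond big_ord_recl /= mul1r.
  exact: eq_bigr.
rewrite mulr_sumr; apply: eq_bigr => i _.
rewrite [RHS]big_mkcond big_ord_recl /=.
congr (_ * _); rewrite [LHS]big_mkcond [RHS]big_mkcond.
by apply: eq_bigr => j _; rewrite (inj_eq lift_inj).
Qed.

(** Synthetic division: comparing coefficients in [P = ('X - x%:P) * Q] gives a recurrence that
    unrolls from the top degree. The factor ['X] lets [k] reach [n], where the identity says that
    [x] is a root of [P]. *)
Lemma coef_deflate (R : comNzRingType) (n : nat) (x : R) (P Q : {poly R}) :
  (size Q <= n)%N -> P = ('X - x%:P) * Q ->
  forall k, (k <= n)%N ->
    ('X * Q)`_(n - k) = \sum_(i < k.+1) P`_(n - i) * x ^+ (k - i).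
Proof.
move=> sQ defP.
have coefP m : ('X * Q)`_m = P`_m + x * ('X * Q)`_m.+1.
  by rewrite defP mulrBl coefB coefCM [('X * Q)`_m.+1]coefXM /= subrK.
elim=> [|k IHk] lekn.
  rewrite big_ord1 subnn expr0 mulr1 coefP subn0 [X in _ * X]coefXM /=.
  by rewrite [Q`_n]nth_default // mulr0 addr0.
rewrite coefP -subSn // subSS IHk 1?ltnW // [RHS]big_ord_recr /= subnn.
rewrite mulr1 addrC.
congr (_ + _); rewrite mulr_sumr; apply: eq_bigr => i _.
by rewrite subSn ?leq_ord // exprS; ring.
Qed.

Lemma size_prod_XsubC_in (R : comNzRingType) (I : finType) (A : {pred I})
    (z : I -> R) : size (\prod_(i in A) ('X - (z i)%:P)) = #|A|.+1.
Proof. by rewrite -big_enum size_prod_XsubC cardE. Qed.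

Lemma newton_prod_XsubC (R : comNzRingType) (n : nat) (z : 'I_n -> R) :
  newton_rel n (fun k => (\prod_i ('X - (z i)%:P))`_(n - k))
    (fun k => \sum_i z i ^+ k.+1).
Proof.
set P := \prod_i _; split.
  have := lead_coef_prod_XsubC (index_enum 'I_n) predT z.
  by rewrite lead_coefE (size_prod_XsubC_in predT) card_ord subn0.
move=> k ltkn.
have : ('X * P^`())`_(n - k.+1) =
       \sum_(i < k.+2) P`_(n - i) * \sum_j z j ^+ (k.+1 - i).
  rewrite deriv_prod_XsubC mulr_sumr coef_sum.
  under [RHS]eq_bigr do rewrite mulr_sumr.
  rewrite exchange_big; apply: eq_bigr => j _ /=.
  apply: coef_deflate => //; last by rewrite /P (bigD1 j).
  rewrite (size_prod_XsubC_in (predC1 j)) cardC1 card_ord.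
  by case: n ltkn {z P j}.
rewrite coefXM coef_deriv big_ord_recr /= subnn.
under [X in _ = _ + _ * X]eq_bigr do rewrite expr0.
rewrite sumr_const card_ord.
under eq_bigr => i _ do rewrite subSn ?leq_ord //.
set S := \sum_(i < k.+1) _ => E.
have {}E : P`_(n - k.+1) *+ (n - k.+1) = S + P`_(n - k.+1) *+ n.
  rewrite -[X in _ = _ + X]mulr_natr -E.
  by case: (n - k.+1)%N => [|m]; rewrite ?mulr0n.
move: E; rewrite mulrnBr // [S + _]addrC => /addrI <-.
by rewrite opprK mulr_natl.
Qed.

(** * Newton's recurrence solved for either sequence *)

(** As [a 0 = 1], the term [i = 0] isolates [p k], so no division occurs. *)
Lemma newton_rel_powers_inj (R : pzRingType) (n : nat) (a p q : nat -> R) :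
  newton_rel n a p -> newton_rel n a q -> forall k, (k < n)%N -> p k = q k.
Proof.
move=> [a0 ap] [_ aq]; elim/ltn_ind=> k IHk ltkn.
have := ap k ltkn; rewrite aq // => /oppr_inj.
rewrite !big_ord_recl /= a0 !mul1r subn0.
suff -> : \sum_(i < k) a (bump 0 i) * q (k - bump 0 i)%N =
          \sum_(i < k) a (bump 0 i) * p (k - bump 0 i)%N by move/addIr.
apply: eq_bigr => i _; have ltik := ltn_ord i.
by rewrite IHk //; rewrite /bump; lia.
Qed.

Lemma newton_rel_coefs_inj (F : numFieldType) (n : nat) (a c p : nat -> F) :
  newton_rel n a p -> newton_rel n c p -> forall k, (k <= n)%N -> a k = c k.
Proof.
move=> [a0 ap] [c0 cp]; elim/ltn_ind=> -[|k] IHk lekn; first by rewrite a0 c0.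
apply: (@mulfI _ k.+1%:R); first by rewrite pnatr_eq0.
rewrite ap // cp //; congr (- _); apply: eq_bigr => i _.
have ltik := ltn_ord i; rewrite IHk //; lia.
Qed.

Lemma newton_rel_ex (F : numFieldType) (n : nat) (p : nat -> F) :
  exists a : nat -> F, newton_rel n a p.
Proof.
elim: n => [|n [a [a0 ap]]]; first by exists (fun=> 1).
pose x := - (\sum_(i < n.+1) a i * p (n - i)%N) / n.+1%:R.
have ltE m k : (k < m)%N -> (k == m) = false by move/ltn_eqF.
(* Only the value at [n.+1] changes, and the earlier relations do not involve it. *)
exists (fun k => if k == n.+1 then x else a k); split=> // k.
rewrite ltnS leq_eqVlt => /predU1P[->|ltkn].
  rewrite eqxx /x mulrC divfK ?pnatr_eq0 //.
  by congr (- _); apply: eq_bigr => i _; rewrite ltE.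
rewrite eqSS ltE // ap //; congr (- _); apply: eq_bigr => i _.
by rewrite ltE // (ltn_trans (ltn_ord i)).
Qed.

(** * Bounds for coefficients and roots *)

(** Each of the [k.+1] products in the recurrence is at most [M ^+ k.+1] in norm, which cancels the
    factor [k.+1]. *)
Lemma newton_rel_bound (F : numFieldType) (n : nat) (a p : nat -> F) (M : F) :
  0 <= M -> newton_rel n a p -> (forall k, (k < n)%N -> `|p k| <= M ^+ k.+1) ->
  forall k, (k <= n)%N -> `|a k| <= M ^+ k.
Proof.
move=> M0 [a0 ap] pM; elim/ltn_ind=> -[|k] IHk lekn; first by rewrite a0 normr1.
rewrite -(ler_pM2l (ltr0Sn F k)) -[k.+1%:R in leLHS]normr_nat -normrM ap //.
rewrite normrN (le_trans (ler_norm_sum _ _ _)) //.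
have -> : k.+1%:R * M ^+ k.+1 = \sum_(i < k.+1) M ^+ k.+1.
  by rewrite sumr_const card_ord mulr_natl.
apply: ler_sum => i _; rewrite normrM; have ltik := ltn_ord i.
rewrite [X in M ^+ X](_ : _ = (i + (k - i).+1)%N); last by lia.
by rewrite exprD ler_pM // ?IHk ?pM //; lia.
Qed.

Lemma cauchy_root_bound (F : numFieldType) (n : nat) (a : nat -> F) (M x : F) :
  0 <= M -> a 0%N = 1 -> (forall k, (k <= n)%N -> `|a k| <= M ^+ k) ->
  \sum_(k < n.+1) a k * x ^+ (n - k) = 0 -> `|x| <= M *+ 2.
Proof.
move=> M0 a0 aM; rewrite big_ord_recl a0 mul1r subn0 => /eqP.
rewrite addr_eq0 => /eqP /(congr1 Num.norm); rewrite normrN normrX => rn.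
rewrite real_leNgt ?realn ?ger0_real ?mulrn_wge0 //.
apply/negP; set r := `|x| in rn *; move=> ltMr.
(* If [r > 2 M] then [M <= h], and the lower terms add up to at most the sum of
   [h ^+ k * r ^+ (n - k)] over [1 <= k <= n]. As [r - h = h], this geometric sum is
   [r ^+ n - h ^+ n]. *)
pose h := r / 2.
have r0 : 0 < r by rewrite (le_lt_trans _ ltMr) // mulrn_wge0.
have h0 : 0 < h by rewrite divr_gt0.
have rE : r = h + h by rewrite /h -splitr.
have leMh : M <= h by rewrite ltW // /h ltr_pdivlMr // mulr_natr.
suff : r ^+ n < r ^+ n by rewrite ltxx.
apply: (@le_lt_trans _ _ (r ^+ n - h ^+ n)); last first.
  by rewrite ltrBlDr ltrDl exprn_gt0.
rewrite {1}rn subrXX {1}rE addrK mulr_sumr.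
rewrite (le_trans (ler_norm_sum _ _ _)) //; apply: ler_sum => i _.
have ltin := ltn_ord i.
rewrite normrM normrX lift0 [leRHS](_ : _ = h ^+ i.+1 * r ^+ (n - i.+1)).
  rewrite ler_pM ?exprn_ge0 ?(ltW r0) // (le_trans (aM _ _)) //.
  by rewrite lerXn2r // nnegrE ltW.
rewrite exprS -mulrA [h ^+ i * _]mulrC.
by have -> : (n.-1 - i = n - i.+1)%N by lia.
Qed.

(** The factor 2 is the square of the constant for [n = 2], where the general bound [2 M] is too
    weak. *)
Lemma pair_root_bound (F : numClosedFieldType) (x y M : F) :
  0 <= M -> `|x + y| <= M -> `|x ^+ 2 + y ^+ 2| <= M ^+ 2 ->
  `|x| ^+ 2 <= M ^+ 2 *+ 2.
Proof.
move=> M0 le1 le2.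
have le1' : `|x + y| ^+ 2 <= M ^+ 2 by rewrite lerXn2r // nnegrE.
have led : `|x - y| ^+ 2 <= M ^+ 2 *+ 3.
  have xyE : (x - y) ^+ 2 = (x ^+ 2 + y ^+ 2) *+ 2 - (x + y) ^+ 2 by ring.
  rewrite -normrX xyE.
  rewrite (le_trans (ler_normB _ _)) // normrMn normrX (mulrSr _ 2) lerD //.
  by rewrite lerMn2r le2.
have le2x : `|x| *+ 2 <= `|x + y| + `|x - y|.
  by rewrite -normrMn (_ : x *+ 2 = (x + y) + (x - y)) ?ler_normD //; ring.
rewrite -(ler_pM2l (ltr0Sn F 3)).
apply: (@le_trans _ _ ((`|x + y| + `|x - y|) ^+ 2)).
  rewrite (_ : 4%:R * _ = (`|x| *+ 2) ^+ 2); last by ring.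
  by rewrite lerXn2r // nnegrE ?mulrn_wge0 // addr_ge0.
apply: (@le_trans _ _ ((`|x + y| ^+ 2 + `|x - y| ^+ 2) *+ 2)).
  rewrite -subr_ge0 [leRHS](_ : _ = (`|x + y| - `|x - y|) ^+ 2); last by ring.
  by rewrite -realEsqr realB ?normr_real.
rewrite (_ : 4%:R * _ = (M ^+ 2 + M ^+ 2 *+ 3) *+ 2); last by ring.
by rewrite lerMn2r lerD.
Qed.

(** * Values of the sine and the constant *)

(** With [s = sin (pi / 6) = cos (pi / 3)], the double angle formula reads [1 - 2 s^2 = s], whose
    only positive root is [1 / 2]. *)
Lemma sin_pi6 (R : realType) : sin (pi / 6) = 1 / 2 :> R.
Proof.
have pi0 := pi_gt0 R; pose x : R := pi / 6.
have sx0 : 0 < sin x by apply: sin_gt0_pihalf; rewrite /x; lra.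
have : cos (x *+ 2) = sin x.
  by rewrite -cosBpihalf -cosN; congr cos; rewrite /x; lra.
by rewrite cos_mulr2n cos2sin2 -/x; nra.
Qed.

Lemma sin_sqr_pi4 (R : realType) : sin (pi / 4) ^+ 2 = 1 / 2 :> R.
Proof.
have : cos ((pi / 4 : R) *+ 2) = 0.
  by rewrite -cos_pihalf; congr cos; lra.
by rewrite cos_mulr2n cos2sin2; lra.
Qed.

Lemma sin_pi_div_gt0 (R : realType) (n : nat) :
  (1 <= n)%N -> 0 < sin (pi / (2 * n%:R)) :> R.
Proof.
move=> n1; have pi0 := pi_gt0 R.
have n1' : 1 <= n%:R :> R by rewrite ler1n.
apply: sin_gt0_pi; rewrite divr_gt0 //=; last lra.
by rewrite ltr_pdivrMr ?ltr_pMr //; lra.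
Qed.

Lemma root_bound_const_ge2 (R : realType) (n : nat) :
  (3 <= n)%N -> 2 <= root_bound_const R n.
Proof.
move=> n3; have pi0 := pi_gt0 R.
have n3' : 3 <= n%:R :> R by rewrite (ler_nat _ 3).
have s0 := sin_pi_div_gt0 R (ltnW (ltnW n3)).
rewrite -[2]invrK lef_pV2 ?posrE ?invr_gt0 //.
rewrite -[leRHS]mul1r -sin_pi6.
have le6 : pi / (2 * n%:R) <= pi / 6 :> R.
  by rewrite ler_pM2l // lef_pV2 ?posrE; lra.
have ge0 : 0 <= pi / (2 * n%:R) :> R by rewrite divr_ge0; lra.
by rewrite leNgt ltr_sin ?in_itv /= -?leNgt //; lra.
Qed.

Lemma cmodE (R : realType) (x : R[i]) : `|x| = (cmod x)%:C.
Proof. by []. Qed.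

Lemma cmod_ge0 (R : realType) (x : R[i]) : 0 <= cmod x.
Proof. by rewrite -lecR -cmodE normr_ge0. Qed.

Lemma max_root_ge0 (R : realType) (n : nat) (b : 'I_n -> R[i]) :
  0 <= max_root b.
Proof. exact: bigmax_ge_id. Qed.

Lemma norm_le_max_root (R : realType) (n : nat) (b : 'I_n -> R[i]) (j : 'I_n) :
  `|b j| <= (max_root b)%:C ^+ j.+1.
Proof.
rewrite cmodE -rmorphXn lecR.
(* Write [cmod (b j)] as the [j.+1]-th power of its [j.+1]-th root. *)
rewrite -[leLHS]powRr1 ?cmod_ge0 // -(@mulVf R j.+1%:R) ?pnatr_eq0 // powRrM.
rewrite powR_mulrn ?powR_ge0 // lerXn2r ?nnegrE ?powR_ge0 ?max_root_ge0 //.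
exact: (le_bigmax _ _ j).
Qed.

Theorem theorem2 (R : realType) (n : nat) (n_ge1 : (1 <= n)%N)
    (b : 'I_n -> R[i]) :
  [/\ exists z : 'I_n -> R[i], power_sum_solution b z,
      forall z w : 'I_n -> R[i],
        power_sum_solution b z -> power_sum_solution b w ->
        exists s : 'S_n, forall i : 'I_n, w i = z (s i)
    & forall z : 'I_n -> R[i], power_sum_solution b z ->
        forall i : 'I_n, cmod (z i) <= root_bound_const R n * max_root b].
Proof.
split.
(* Extends [b] by 0 to all of [nat]; the relations up to [n] only read indices below [n]. *)
- pose p k := oapp b 0 (insub k).
  have [a aP] := newton_rel_ex n p.
  pose P := \poly_(i < n.+1) a (n - i)%N.
  have Pk k : (k <= n)%N -> P`_(n - k) = a k.
    by move=> lekn; rewrite coef_poly ltnS leq_subr subKn.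
  have sP : size P = n.+1.
    by apply: size_poly_eq; rewrite subnn aP.1 oner_neq0.
  have [r] := closed_field_poly_normal P.
  have -> : lead_coef P = 1.
    by rewrite lead_coefE sP /= -[n in _`_n]subn0 Pk // aP.1.
  rewrite scale1r => defP.
  have sr : size r == n by rewrite -eqSS -sP defP size_prod_XsubC.
  pose z (i : 'I_n) := tnth (Tuple sr) i.
  have defPz : P = \prod_i ('X - (z i)%:P).
    by rewrite defP -(big_tuple _ _ (Tuple sr) predT (fun x => 'X - x%:P)).
  (* The power sums of the roots and [p] now obey Newton's recurrence with the same coefficients,
     hence agree. *)
  have zP : newton_rel n a (fun k => \sum_i z i ^+ k.+1).
    have [_ zP] := newton_prod_XsubC z; rewrite -defPz in zP.
    split=> [|k ltkn]; first exact: aP.1.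
    rewrite -Pk // zP //; congr (- _); apply: eq_bigr => i _.
    by rewrite Pk // (leq_trans _ ltkn) // ltnW.
  exists z => j; rewrite (newton_rel_powers_inj zP aP) // /p.
  by rewrite valK.
- move=> z w zb wb.
  have newton_b v : power_sum_solution b v ->
      newton_rel n (fun k => (\prod_i ('X - (v i)%:P))`_(n - k))
        (fun k => oapp b 0 (insub k)).
    move=> vb; have [v0 vP] := newton_prod_XsubC v.
    split=> // k ltkn; rewrite vP //; congr (- _); apply: eq_bigr => i _.
    have ltin : (k - i < n)%N by rewrite (leq_ltn_trans _ ltkn) // leq_subr.
    by rewrite insubT /= -vb.
  have eqP : \prod_i ('X - (z i)%:P) = \prod_i ('X - (w i)%:P).
    apply/polyP => k; case: (leqP k n) => [lekn|ltnk].
      have eq_coef := newton_rel_coefs_inj (newton_b z zb) (newton_b w wb).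
      by have := eq_coef _ (leq_subr k n); rewrite subKn.
    by rewrite !nth_default // (size_prod_XsubC_in predT) card_ord.
  (* Unique factorization: equal products have the same roots with multiplicity. *)
  have : perm_eq [tuple w i | i < n] [tuple z i | i < n].
    apply: prod_XsubC_eq; rewrite !big_tuple.
    under eq_bigr do rewrite tnth_mktuple.
    by under [RHS]eq_bigr do rewrite tnth_mktuple.
  case/tuple_permP => s E; exists s => i.
  have /(congr1 (fun t : n.-tuple _ => tnth t i)) := val_inj E.
  by rewrite !tnth_mktuple.
- move=> z zb i.
  have M0 : 0 <= (max_root b)%:C by rewrite lecR max_root_ge0.
  have leb := norm_le_max_root b.
  have zP := newton_prod_XsubC z.
  set P := \prod_i _ in zP.
  have aM : forall k, (k <= n)%N -> `|P`_(n - k)| <= (max_root b)%:C ^+ k.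
    apply: newton_rel_bound M0 zP _ => k ltkn.
    by rewrite (zb (Ordinal ltkn)); apply: leb (Ordinal ltkn).
  have Pz : \sum_(k < n.+1) P`_(n - k) * z i ^+ (n - k) = 0.
    have : P.[z i] = 0.
      by rewrite /P (bigD1 i) //= hornerM hornerXsubC subrr mul0r.
    rewrite horner_coef (size_prod_XsubC_in predT) card_ord => P0.
    by rewrite -[RHS]P0 [RHS](reindex_inj rev_ord_inj).
  have le2 : cmod (z i) <= max_root b *+ 2.
    rewrite -lecR -cmodE rmorphMn.
    exact: cauchy_root_bound M0 zP.1 aM Pz.
  have M0' := max_root_ge0 b.
  have [n3|] := leqP 3 n.
    rewrite (le_trans le2) // -mulr_natl ler_wpM2r //.
    exact: root_bound_const_ge2.
  clear zP P aM Pz le2.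
  case: n n_ge1 b z zb i M0 leb M0'
    => [|[|[|//]]] // _ b z zb i M0 leb M0' _.
    (* For [n = 1] the constant is 1 and the only unknown equals [b ord0]. *)
    rewrite /root_bound_const mulr1 sin_pihalf invr1 mul1r -lecR -cmodE.
    by have := leb i; rewrite -zb big_ord1 (ord1 i) !expr1.
  have := zb ord0; have := zb ord_max; rewrite !big_ord_recl !big_ord0 !addr0.
  set x := z ord0; set y := z (lift _ _); rewrite !expr1 => zb2 zb1.
  have lez : `|z i| ^+ 2 <= (max_root b)%:C ^+ 2 *+ 2.
    have := leb ord0; have := leb ord_max; rewrite -zb1 -zb2 !expr1 => le2 le1.
    have [->|->] : i = ord0 \/ i = lift ord0 ord0.
      by case: i => [[|[|//]] lti]; [left|right]; apply: val_inj.
    - exact: pair_root_bound le1 le2.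
    - by apply: (@pair_root_bound _ y x) => //; rewrite addrC.
  have s0 := sin_pi_div_gt0 R (isT : (1 <= 2)%N).
  (* Only the square of the constant is needed, since the bound is compared after squaring. *)
  have C2 : root_bound_const R 2 ^+ 2 = 2.
    rewrite /root_bound_const exprVn -natrM sin_sqr_pi4.
    by rewrite div1r invrK.
  have C0 : 0 <= root_bound_const R 2 by rewrite invr_ge0 ltW.
  rewrite -(@ler_pXn2r _ 2) ?nnegrE ?cmod_ge0 ?mulr_ge0 //.
  by rewrite exprMn C2 mulr_natl -lecR rmorphMn !rmorphXn.
Qed.
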